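(* Let $G$ be a connected non-complete graph. Suppose that either $C(G)$ is edgeless, or $C(G)$ is a linear forest whose components $Q_1, Q_2, \ldots, Q_k$ ($k\geq 1$), with $n_i = |V(Q_i)|$ ordered so that $2\leq n_1\leq n_2\leq\cdots\leq n_k$, satisfy $2 = n_1 = n_2 = \cdots = n_{k-1} \leq n_k \leq 4$. Then $cfc(G) = 2$.
   Context: All graphs are finite, simple and undirected. For a graph $G$, $C(G)$ denotes the subgraph of $G$ induced by the set of cut-edges of $G$ (the subgraph formed by the cut-edges and their endpoints). A linear forest is a forest each of whose components is a path. An edge-coloring of a connected graph (adjacent edges may receive the same color) is a conflict-free connection coloring if every pair of distinct vertices is joined by a path containing at least one color that is used on exactly one edge of that path. The conflict-free connection number $cfc(G)$ is the smallest number of colors in a conflict-free connection coloring of $G$. *)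

(* Defs.v *)
From HB Require Import structures.
From mathcomp Require Import all_boot.

Set Implicit Arguments.
Unset Strict Implicit.
Unset Printing Implicit Defensive.

Record sgraph := SGraph {
  svertex :> finType;
  sedge : rel svertex;
  sedge_sym : symmetric sedge;
  sedge_irr : irreflexive sedge }.

Definition edges (G : sgraph) : {set {set G}} :=
  [set A | [exists x : G, exists y : G, sedge x y && (A == [set x; y])]].

Definition connected (G : sgraph) : Prop :=
  0 < #|G| /\ forall x y : G, connect (@sedge G) x y.

Definition complete (G : sgraph) : Prop :=
  forall x y : G, x != y -> sedge x y.

Definition edgeless (G : sgraph) : Prop := edges G = set0.

(* Components are represented by their vertex sets. *)
Definition components (G : sgraph) : {set {set G}} :=
  [set [set y | connect (@sedge G) x y] | x : G].

Section DeleteEdge.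
Variables (G : sgraph) (A : {set G}).

Definition del_edge_rel : rel G :=
  fun x y => sedge x y && ([set x; y] != A).

Lemma del_edge_sym : symmetric del_edge_rel.
Proof. by move=> x y; rewrite /del_edge_rel sedge_sym setUC. Qed.

Lemma del_edge_irr : irreflexive del_edge_rel.
Proof. by move=> x; rewrite /del_edge_rel sedge_irr. Qed.

Definition del_edge : sgraph := SGraph del_edge_sym del_edge_irr.
End DeleteEdge.

Definition cut_edge (G : sgraph) (A : {set G}) : bool :=
  (A \in edges G) && (#|components G| < #|components (del_edge A)|).

Section CutEdgeSubgraph.
Variable G : sgraph.

Definition cut_vertexType : finType :=
  {x : G | [exists A : {set G}, cut_edge A && (x \in A)]}.

Definition cut_rel : rel cut_vertexType :=
  fun x y => cut_edge [set val x; val y].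

Lemma cut_rel_sym : symmetric cut_rel.
Proof. by move=> x y; rewrite /cut_rel setUC. Qed.

Lemma cut_rel_irr : irreflexive cut_rel.
Proof.
move=> x; apply/negP => /andP[+ _]; rewrite inE.
case/existsP=> u /existsP[v /andP[uv /eqP E]].
have /set1P uE : u \in [set val x] by rewrite -[[set _]]setUid E set21.
have /set1P vE : v \in [set val x] by rewrite -[[set _]]setUid E set22.
by rewrite uE vE sedge_irr in uv.
Qed.

(* The subgraph C(G). *)
Definition cut_graph : sgraph := SGraph cut_rel_sym cut_rel_irr.
End CutEdgeSubgraph.

(* The edges traversed by the walk x :: p, in order. *)
Definition walk_edges (G : sgraph) (x : G) (p : seq G) : seq {set G} :=
  pairmap (fun u v => [set u; v]) x p.

Definition forest (G : sgraph) : Prop :=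
  forall s : seq G, 3 <= size s -> uniq s -> ~~ cycle (@sedge G) s.

(* The subgraph induced on A is a path, with vertices x :: p in this order. *)
Definition induces_path (G : sgraph) (A : {set G}) : Prop :=
  exists (x : G) (p : seq G),
    [/\ uniq (x :: p), A =i x :: p
      & {in A &, forall u v, sedge u v = ([set u; v] \in walk_edges x p)}].

Definition linear_forest (G : sgraph) : Prop :=
  forest G /\ forall A, A \in components G -> induces_path A.

Definition path_between (G : sgraph) (x y : G) (p : seq G) : Prop :=
  [/\ path (@sedge G) x p, last x p = y & uniq (x :: p)].

(* Colourings are total on {set G}; only their values on edges G matter. *)
Definition cf_coloring (G : sgraph) (c : {set G} -> nat) : Prop :=
  forall x y : G, x != y ->
    exists p : seq G, path_between x y p /\
      exists a : nat, count_mem a (map c (walk_edges x p)) = 1.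

Definition num_colors (G : sgraph) (c : {set G} -> nat) : nat :=
  size (undup [seq c A | A <- enum (edges G)]).

(* is_cfc G k means cfc(G) = k. *)
Definition is_cfc (G : sgraph) (k : nat) : Prop :=
  (exists c : {set G} -> nat, cf_coloring c /\ num_colors c = k) /\
  (forall c : {set G} -> nat, cf_coloring c -> k <= num_colors c).

(* Main.v *)
Require Import Defs.
From HB Require Import structures.
From mathcomp Require Import all_boot.

(** Let R be a maximal set of edges meeting every cycle at most once. By
maximality every non-cut edge lies on a cycle with exactly one edge in R. Colour
red the non-cut edges of R together with one cut-edge m (the second edge of the
largest component of C(G), if it has at least two edges), and everything else
blue. A red non-cut edge can be bypassed along its cycle, so any two vertices
are joined by a path P without red edges except possibly m. If P contains m, or
has length one, it is conflict-free. Otherwise P cannot consist of cut-edges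
only, since m is one of any two adjacent cut-edges; so P contains a non-cut
edge, which lies on a cycle C with exactly one red edge r. Replacing the part of
P between its first and its last vertex on C by the arc of C through r gives a
path whose only red edge is r. *)

Set Implicit Arguments.
Unset Strict Implicit.
Unset Printing Implicit Defensive.

(** Serves to leave a cycle for good: with [P] being membership in the cycle, nothing after [b]
    meets it again. *)
Lemma split_last (T : Type) (P : pred T) (l : seq T) : has P l ->
  exists l1 b l2, [/\ l = l1 ++ b :: l2, P b & ~~ has P l2].
Proof.
elim: l => //= c l IH; case hl: (has P l).
  by have [l1 [b [l2 [-> Pb Pl2]]]] := IH hl; exists (c :: l1), b, l2.
by rewrite orbF => Pc; exists [::], c, l; rewrite hl.
Qed.

(** * Walks and the edges they traverse *)

Section Walks.
Variable G : sgraph.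
Implicit Types (x y a b u v : G) (p q s : seq G) (A : {set G}).

Lemma walk_edges_cat x p q :
  walk_edges x (p ++ q) = walk_edges x p ++ walk_edges (last x p) q.
Proof. exact: pairmap_cat. Qed.

Lemma walk_edges_rcons x p y :
  walk_edges x (rcons p y) = rcons (walk_edges x p) [set last x p; y].
Proof. by rewrite -cats1 walk_edges_cat cats1. Qed.

Lemma walk_edges_rev x p :
  walk_edges (last x p) (rev (belast x p)) = rev (walk_edges x p).
Proof.
elim: p x => //= y p IH x.
rewrite rev_cons walk_edges_rcons IH rev_cons; congr rcons.
by case: p {IH} => [|z p] /=; rewrite ?rev_cons ?last_rcons setUC.
Qed.

Lemma walk_edges_sub x p A : A \in walk_edges x p -> {subset A <= x :: p}.
Proof.
elim: p x => //= y p IH x; rewrite inE => /orP[/eqP-> z|/IH sub z /sub].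
  by rewrite !inE => /orP[]/eqP->; rewrite eqxx ?orbT.
by rewrite [in X in _ -> X]inE => ->; rewrite orbT.
Qed.

Lemma notin_walk_edges x p A a : a \in A -> a \notin x :: p ->
  A \notin walk_edges x p.
Proof. by move=> aA; apply: contra => /walk_edges_sub; apply. Qed.

Lemma walk_edges_uniq x p : uniq (x :: p) -> uniq (walk_edges x p).
Proof.
elim: p x => //= y p IH x /andP[xp up]; rewrite IH // andbT.
by apply: notin_walk_edges xp; rewrite set21.
Qed.

Lemma sedge_neq x y : sedge x y -> x != y.
Proof. by apply: contraTneq => ->; rewrite sedge_irr. Qed.

Lemma mem_edges x y : ([set x; y] \in edges G) = sedge x y.
Proof.
rewrite inE; apply/existsP/idP => [[u /existsP[v /andP[uv /eqP E]]]|xy]; last first.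
  by exists x; apply/existsP; exists y; rewrite xy eqxx.
have uxy : u \in [set x; y] by rewrite E set21.
have vxy : v \in [set x; y] by rewrite E set22.
move: uxy vxy uv; rewrite !inE.
by case/orP=> /eqP-> /orP[]/eqP->; rewrite ?sedge_irr // sedge_sym.
Qed.

Lemma walk_edges_edges x p A :
  path (@sedge G) x p -> A \in walk_edges x p -> A \in edges G.
Proof.
elim: p x => //= y p IH x /andP[xy pp]; rewrite inE => /orP[/eqP->|].
  by rewrite mem_edges.
exact: IH.
Qed.

Lemma walk_edge_ends x p A : path (@sedge G) x p -> A \in walk_edges x p ->
  exists u v, [/\ A = [set u; v], u \in x :: p, v \in x :: p & sedge u v].
Proof.
move=> pp Ap; have := walk_edges_edges pp Ap.
rewrite inE => /existsP[u /existsP[v /andP[uv /eqP AE]]].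
have sub := walk_edges_sub Ap.
by exists u, v; split=> //; apply: sub; rewrite AE !inE eqxx ?orbT.
Qed.

(** * Cycles, their arcs, and rerouting a path through a cycle *)

Definition cycle_edges s : seq {set G} :=
  if s is x :: p then walk_edges x (rcons p x) else [::].

Definition graph_cycle s := [&& 2 < size s, uniq s & cycle (@sedge G) s].

(** Lets a cycle be read from any of its vertices without changing how many of its edges satisfy a
    predicate. *)
Lemma cycle_edges_rot n s : perm_eq (cycle_edges (rot n s)) (cycle_edges s).
Proof.
rewrite /rot -{3}(cat_take_drop n s).
case: (take n s) (drop n s) => [|a s1] [|b s2] //=; rewrite ?cats0 //.
rewrite !rcons_cat /= -!cat_rcons !walk_edges_cat !last_rcons.
by rewrite perm_catC.
Qed.

(** Three vertices are required: on two, the closing edge would repeat the first edge. *)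
Lemma cycle_edges_uniq s : 2 < size s -> uniq s -> uniq (cycle_edges s).
Proof.
case: s => [//|a [//|b p]] /= sz /and3P[ap bp up].
move: (ap); rewrite inE => /norP[ab _].
rewrite walk_edges_rcons mem_rcons inE rcons_uniq negb_or.
rewrite !(@notin_walk_edges b p _ a) ?set21 ?set22 //= walk_edges_uniq ?andbT;
  last by rewrite /= bp.
(* It remains to separate the first edge from the closing one; were they equal, [b] would also be
   the last vertex of the nonempty [p]. *)
apply/eqP => E; have : b \in [set last b p; a] by rewrite -E set22.
rewrite !inE [b == a]eq_sym (negbTE ab) orbF => /eqP bl.
case: p sz bp {ap up E} bl => // c p _ + bl.
by rewrite {1}bl /= mem_last.
Qed.

Lemma cycle_edges_sub s A : A \in cycle_edges s -> {subset A <= s}.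
Proof.
case: s => //= x p /walk_edges_sub sub z /sub.
by rewrite !inE mem_rcons inE orbA orbb.
Qed.

Lemma cycle_edges_edges s A :
  cycle (@sedge G) s -> A \in cycle_edges s -> A \in edges G.
Proof. by case: s => //= x p; apply: walk_edges_edges. Qed.

(* Exactly one of the two arcs between [a] and [b] carries the [P]-edge. *)
Lemma cycle_arcs (P : pred {set G}) s a b :
  graph_cycle s -> a \in s -> b \in s -> a != b ->
  count P (cycle_edges s) = 1 ->
  forall i, i < 2 ->
  exists p, [/\ path_between a b p, {subset p <= s}
             & count P (walk_edges a p) = i].
Proof.
case/and3P=> _ us cs ia ib ab.
have [n s' rs] := rot_to ia.
rewrite -(permP (cycle_edges_rot n s)) rs.
have: uniq (a :: s') by rewrite -rs rot_uniq.
have: cycle (@sedge G) (a :: s') by rewrite -rs rot_cycle.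
have ms : s =i a :: s' by move=> z; rewrite -rs mem_rot.
move: ib; rewrite ms inE eq_sym (negbTE ab) /= => ib {ia us cs rs n}.
case/splitPr: ib ms => p1 p2 ms.
rewrite /cycle_edges /= rcons_cat /= -cat_rcons cat_path last_rcons.
rewrite walk_edges_cat last_rcons count_cat.
move=> /andP[pp1 pp2] /andP[ap up].
set k1 := count P _; set k2 := count P _ => k12.
have arc1 : exists p, [/\ path_between a b p, {subset p <= s}
             & count P (walk_edges a p) = k1].
  exists (rcons p1 b); split=> //.
    split=> //; first by rewrite last_rcons.
    move: ap up; rewrite -cat_rcons mem_cat negb_or cat_uniq /=.
    by case/andP=> -> _ /andP[-> _].
  by move=> z zp; rewrite ms inE -cat_rcons mem_cat zp orbT.
have arc2 : exists p, [/\ path_between a b p, {subset p <= s}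
             & count P (walk_edges a p) = k2].
  (* The other arc runs from [b] through [p2] to [a], so it is read backwards. *)
  exists (rev (belast b (rcons p2 a))); split=> //.
  - split.
    + have := rev_path (@sedge G) b (rcons p2 a); rewrite last_rcons => ->.
      by rewrite (eq_path (e' := @sedge G)) // => u v; rewrite /= sedge_sym.
    + by rewrite belast_rcons /= rev_cons last_rcons.
    + rewrite belast_rcons -rev_rcons rev_uniq rcons_uniq.
      move: ap up; rewrite mem_cat negb_or cat_uniq.
      by case/andP=> _ -> /and3P[].
  - move=> z; rewrite mem_rev belast_rcons => zp.
    by rewrite ms inE mem_cat zp !orbT.
  - have := walk_edges_rev b (rcons p2 a); rewrite last_rcons => ->.
    by rewrite count_rev.
(* The counts on the two arcs add up to 1, so they are 0 and 1 in some order, and [i] selects the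
   arc. *)
move: k12; case: k1 arc1 => [|[|k1]] arc1.
- rewrite add0n => k21; rewrite k21 in arc2.
  by case=> [|[|i]].
- by rewrite add1n => -[k20]; rewrite k20 in arc2; case=> [|[|i]].
- by [].
Qed.

(* Follow the path up to its first vertex on the cycle, then the arc through
   the P-edge up to the last vertex of the path on the cycle. *)
Lemma reroute_through_cycle (P : pred {set G}) s x p :
  graph_cycle s -> count P (cycle_edges s) = 1 ->
  path (@sedge G) x p -> uniq (x :: p) -> ~~ has P (walk_edges x p) ->
  (exists u v, [/\ u \in x :: p, v \in x :: p, u \in s, v \in s & u != v]) ->
  exists q, [/\ path_between x (last x p) q,
    {subset q <= (x :: p) ++ s} & count P (walk_edges x q) = 1].
Proof.
move=> cs c1; elim: p x => [|y p IH] x.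
  move=> _ _ _ [u [v [+ + _ _]]].
  by rewrite !inE => /eqP-> /eqP->; rewrite eqxx.
case xs: (x \in s).
  move=> pp up nP [u [v [ux vx us vs uv]]].
  have hp : has (mem s) (y :: p).
    apply/hasP; case: (eqVneq u x) ux vx => [ux _|ux].
      by rewrite inE -ux eq_sym (negbTE uv) => vx; exists v.
    by rewrite inE (negbTE ux) => {}ux _; exists u.
  have [l1 [b [l2 [E bs l2s]]]] := split_last hp.
  move: pp up nP; rewrite E cat_path cat_cons cons_uniq /=.
  rewrite last_cat /= walk_edges_cat has_cat negb_or mem_cat inE !negb_or.
  rewrite cat_uniq /=.
  case/and3P=> pl1 lb pl2 /andP[/and3P[xl1 xb xl2] /and4P[_ _ bl2 ul2]].
  case/and3P=> _ _ nPl2.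
  have [q [[pq lq uq] qs q1]] := cycle_arcs cs xs bs xb c1 (isT : 1 < 2).
  exists (q ++ l2); split.
  - split.
    + by rewrite cat_path pq lq.
    + by rewrite last_cat lq.
    (* The arc stays on [s], while [l2] avoids [s] because [b] is the last vertex of the path on
       it. *)
    + rewrite -cat_cons cat_uniq uq ul2 andbT /= -all_predC.
      apply/allP=> z zl2 /=; rewrite inE negb_or.
      apply/andP; split; first by apply: contraNneq xl2 => <-.
      by apply: contra l2s => /qs zs; apply/hasP; exists z.
  - move=> z; rewrite mem_cat => /orP[/qs zs|zl2].
      by rewrite inE !mem_cat zs !orbT.
    by rewrite inE !mem_cat inE zl2 !orbT.
  - rewrite walk_edges_cat count_cat lq q1; apply/eqP.
    by rewrite -[1]addn0 eqn_add2l -leqn0 leqNgt -has_count.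
move=> /= /andP[xy pp] /andP[xp up] /norP[nPxy nP] [u [v [ux vx us vs uv]]].
have off w : w \in s -> w \in [:: x, y & p] -> w \in y :: p.
  by move=> ws; rewrite inE => /orP[/eqP wx|//]; rewrite -wx ws in xs.
have [|q [[pq lq uq] qs q1]] := IH y pp up nP.
  by exists u, v; split=> //; apply: off.
exists (y :: q); split.
- split=> //=; first by rewrite xy.
  (* Here the bound on the vertices of [q] pays off: [x] lies neither on the rest of the path nor on
     [s]. *)
  rewrite [x \notin _](_ : _ = true) //.
  apply/negP; rewrite inE => /orP[/eqP xE|/qs].
    by rewrite xE inE eqxx in xp.
  by rewrite mem_cat (negbTE xp) xs.
- move=> z; rewrite inE => /orP[/eqP->|/qs]; first by rewrite !inE eqxx orbT.
  by rewrite cat_cons [in X in _ -> X]inE => ->; rewrite orbT.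
- by rewrite /= (negbTE nPxy) q1.
Qed.

(** * Cut-edges as the edges on no cycle, and the transversal *)

Lemma connect_uniq_path (e : rel G) x y : connect e x y ->
  exists p, [/\ path e x p, last x p = y & uniq (x :: p)].
Proof. by case/connectP=> p /shortenP[q pq uq _] ->; exists q. Qed.

(** The arc of the cycle that avoids [A] still joins the ends of [A], so deleting [A] leaves
    reachability, hence the components, unchanged. *)
Lemma cut_edge_not_in_cycle s A : graph_cycle s -> A \in cycle_edges s ->
  ~~ cut_edge A.
Proof.
move=> cs As; have /and3P[sz us cys] := cs.
have Ae := cycle_edges_edges cys As.
rewrite /cut_edge Ae /= -leqNgt.
have := Ae; rewrite inE => /existsP[u /existsP[v /andP[uv /eqP AE]]].
have sub := cycle_edges_sub As.
have c1 : count (pred1 A) (cycle_edges s) = 1.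
  by rewrite count_uniq_mem ?As // cycle_edges_uniq.
have con a b : a \in s -> b \in s -> a != b -> connect (del_edge_rel A) a b.
  move=> ia ib ab.
  have [q [[pq <- _] _]] := cycle_arcs cs ia ib ab c1 (isT : 0 < 2).
  move=> /eqP; rewrite -leqn0 leqNgt -has_count => q0.
  apply/connectP; exists q => //.
  elim: q a pq q0 {ia ib ab} => //= c q IH a /andP[ac pq] /norP[nA q0].
  by rewrite {1}/del_edge_rel ac nA /= IH.
have us' : u \in s by apply: sub; rewrite AE set21.
have vs' : v \in s by apply: sub; rewrite AE set22.
have eqc : connect (@sedge G) =2 connect (del_edge_rel A).
  move=> a b; apply/idP/idP; apply: connect_sub => c d; last first.
    by case/andP=> cd _; apply: connect1.
  case E : ([set c; d] == A) => cd; last first.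
    by apply: connect1; rewrite /del_edge_rel cd E.
  by apply: con (sedge_neq cd); apply: sub; rewrite -(eqP E) !inE eqxx ?orbT.
apply/subset_leq_card/subsetP=> B /imsetP[x _ ->].
apply/imsetP; exists x => //; apply/setP => y; rewrite !inE.
by rewrite eqc.
Qed.

(** If deleting [A] separated its ends, the single component of [G] would become at least two. So a
    path avoiding [A] joins them, and [A] closes it to a cycle. *)
Lemma noncut_edge_in_cycle A : connected G -> A \in edges G -> ~~ cut_edge A ->
  exists2 s, graph_cycle s & A \in cycle_edges s.
Proof.
move=> [_ Gc] Ae; rewrite /cut_edge Ae /= -leqNgt => le.
have := Ae; rewrite inE => /existsP[u /existsP[v /andP[uv /eqP AE]]].
have cuv : connect (del_edge_rel A) u v.
  apply: contraLR le => nuv; rewrite -ltnNge.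
  have cG : components G \subset [set [set: G]].
    apply/subsetP=> B /imsetP[x _ ->]; rewrite inE; apply/eqP/setP => y.
    by rewrite !inE Gc.
  rewrite (leq_ltn_trans (subset_leq_card cG)) // cards1.
  apply/card_gt1P; exists [set y | connect (@sedge (del_edge A)) u y],
    [set y | connect (@sedge (del_edge A)) v y]; split.
  - exact: imset_f.
  - exact: imset_f.
  - apply: contra nuv => /eqP/setP/(_ v); rewrite !inE.
    by rewrite connect0.
have [p [pp lp up]] := connect_uniq_path cuv.
have pG : path (@sedge G) u p by apply: sub_path pp => a b /andP[].
exists (u :: p).
  rewrite /graph_cycle up /= rcons_path pG lp sedge_sym uv !andbT ltnS.
  (* The cycle has at least three vertices: a shorter path would make [A] a loop or be the deleted
     edge itself. *)
  case: p pp lp up {pG} => [_ /= E|a [|//] /=]; first by rewrite E sedge_irr in uv.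
  by move=> + aE; rewrite aE /del_edge_rel AE eqxx andbF.
by rewrite /= walk_edges_rcons mem_rcons inE lp AE setUC eqxx.
Qed.

(* [R] is a maximal set of edges meeting every cycle at most once; the cycle
   forbidding the addition of [A] to [R] is the one wanted. *)
Lemma exists_cycle_transversal : connected G ->
  exists R : {set {set G}}, forall A, A \in edges G -> ~~ cut_edge A ->
    exists s, [/\ graph_cycle s, A \in cycle_edges s
                & count (mem R) (cycle_edges s) = 1].
Proof.
move=> Gc.
(* A cycle has at most [#|G|] vertices, so bounded sequences cover all cycles and make the property
   boolean, as [maxset] requires. *)
pose good (R : {set {set G}}) := [forall s : #|G|.-bseq G,
   graph_cycle s ==> (count (mem R) (cycle_edges s) <= 1)].
have goodP R s : good R -> graph_cycle s -> count (mem R) (cycle_edges s) <= 1.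
  move=> /forallP gR cs; have us : uniq s by case/and3P: cs.
  have sz : size s <= #|G| by rewrite -(card_uniqP us) max_card.
  by have /implyP := gR (Bseq sz); apply.
have g0 : good set0.
  apply/forallP=> s; apply/implyP=> _.
  by rewrite (@eq_count _ _ pred0) ?count_pred0 // => A; rewrite /= inE.
have [R /maxsetP[gR maxR] _] := maxset_exists g0.
exists R => A Ae ncA.
case AR : (A \in R).
  have [s cs As] := noncut_edge_in_cycle Gc Ae ncA; exists s; split=> //.
  apply/eqP; rewrite eqn_leq goodP //= -has_count.
  by apply/hasP; exists A.
have : ~~ good (A |: R).
  apply: contraFN AR => g; rewrite -(maxR _ g) ?setU11 //.
  exact: subsetUr.
rewrite negb_forall => /existsP[s]; rewrite negb_imply -ltnNge => /andP[cs].
have /and3P[sz us _] := cs; have ue := cycle_edges_uniq sz us.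
have -> : count (mem (A |: R)) (cycle_edges s) =
          (A \in cycle_edges s) + count (mem R) (cycle_edges s).
  rewrite -count_uniq_mem // -count_predUI.
  rewrite [X in _ = _ + X](@eq_count _ _ pred0) ?count_pred0 ?addn0.
    by apply: eq_count => B; rewrite /= !inE.
  by move=> B /=; apply/andP=> -[/eqP-> AR']; rewrite AR' in AR.
have le1 := goodP R s gR cs.
(* The count for [A |: R] exceeds 1 while that for [R] does not, so [A] is on the cycle and [R]
   meets it exactly once. *)
case As : (A \in _) => lt; last by rewrite leqNgt lt in le1.
by exists (val s); split=> //; apply/eqP; rewrite eqn_leq le1.
Qed.

End Walks.

(** * The lower bound and the two-colouring *)

(** With a single colour, only a path of length one has a colour used exactly once, so any two
    vertices would be adjacent. *)
Lemma num_colors_ge2 (G : sgraph) (c : {set G} -> nat) :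
  ~ complete G -> cf_coloring c -> 2 <= num_colors c.
Proof.
move=> nc cf; rewrite ltnNge; apply/negP => le1; apply: nc => x y xy.
have mono A B : A \in edges G -> B \in edges G -> c A = c B.
  move=> Ae Be; move: le1; rewrite /num_colors.
  have : c A \in undup [seq c A | A <- enum (edges G)].
    by rewrite mem_undup map_f // mem_enum.
  have : c B \in undup [seq c A | A <- enum (edges G)].
    by rewrite mem_undup map_f // mem_enum.
  case: (undup _) => [//|a [|//]]; rewrite !inE.
  by move=> /eqP-> /eqP->.
have [p [[pp lp up] [a ca]]] := cf _ _ xy.
case: p pp lp up ca => [_ /= E|z [|w p]]; first by rewrite E eqxx in xy.
  by move=> /= /andP[xz _] <-.
move=> pp _ _.
have sameA A : A \in walk_edges x [:: z, w & p] -> c A = c [set x; z].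
  move=> /(walk_edges_edges pp) Ae; apply: mono => //.
  by rewrite mem_edges; case/andP: pp.
have -> : map c (walk_edges x [:: z, w & p]) =
    nseq (size p).+2 (c [set x; z]).
  have -> : (size p).+2 = size (walk_edges x [:: z, w & p]).
    by rewrite size_pairmap.
  elim: (walk_edges _ _) sameA => //= A l IH h.
  rewrite h ?mem_head // IH // => B Bl; apply: h.
  by rewrite inE Bl orbT.
by rewrite count_nseq; case: (pred1 a _) => //; rewrite mul1n.
Qed.

(* [m] need not be an edge: [set0] is a legitimate choice when no two cut-edges
   are adjacent. *)
Lemma cf_two_coloring (G : sgraph) (m : {set G}) :
  connected G -> (m \in edges G -> cut_edge m) ->
  (forall x y z : G, x != z -> cut_edge [set x; y] -> cut_edge [set y; z] ->
     m = [set x; y] \/ m = [set y; z]) ->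
  exists2 c : {set G} -> nat, cf_coloring c & num_colors c <= 2.
Proof.
move=> Gc mcut mE; have [R RP] := exists_cycle_transversal Gc.
(* Dropping the cut-edges from [R] changes no count on a cycle, and leaves [m] as the only possible
   red cut-edge. *)
pose B := [pred A : {set G} | (A \in R) && ~~ cut_edge A].
pose c A : nat := (A == m) || B A.
exists c; last first.
  rewrite /num_colors; apply: (@uniq_leq_size _ _ [:: 0; 1]).
    exact: undup_uniq.
  move=> k; rewrite mem_undup => /mapP[A _ ->].
  by rewrite /c; case: (_ || _).
have cB s : graph_cycle s -> count B (cycle_edges s) = count (mem R) (cycle_edges s).
  move=> cs; apply: eq_in_count => A As /=.
  by rewrite (cut_edge_not_in_cycle cs As) andbT.
(* Each edge in [B] is replaced by the arc of its cycle that contains no edge of [B]. *)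
have blue x y : connect (fun u v => sedge u v && ~~ B [set u; v]) x y.
  apply: (connect_sub _ (proj2 Gc x y)) => u v uv.
  case Buv : (B [set u; v]); last by apply: connect1; rewrite uv Buv.
  have /andP[_ nc] := Buv.
  have uve : [set u; v] \in edges G by rewrite mem_edges.
  have [s [cs As c1]] := RP _ uve nc; rewrite -cB // in c1.
  have sub := cycle_edges_sub As.
  have us : u \in s by apply: sub; rewrite set21.
  have vs : v \in s by apply: sub; rewrite set22.
  have [q [[pq <- _] _]] := cycle_arcs cs us vs (sedge_neq uv) c1 (isT : 0 < 2).
  move=> /eqP; rewrite -leqn0 leqNgt -has_count => q0.
  apply/connectP; exists q => //.
  elim: q (u) pq q0 => //= d q IH a /andP[-> pq] /norP[-> q0] /=.
  exact: IH.
have count_c l : count_mem 1 (map c l) = count (predU (pred1 m) B) l.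
  rewrite count_map; apply: eq_count => A /=.
  by rewrite /c /=; case: (_ || _).
move=> x y xy.
have [p [pp lp up]] := connect_uniq_path (blue x y).
have pG : path (@sedge G) x p by apply: sub_path pp => a b /andP[].
have pB : ~~ has B (walk_edges x p).
  elim: p x pp {lp up pG xy} => //= d p IH x /andP[/andP[_ nB] pp].
  by rewrite negb_or nB IH.
case mp : (m \in walk_edges x p).
  exists p; split=> //; exists 1; rewrite count_c.
  have : count (predU (pred1 m) B) (walk_edges x p) = count_mem m (walk_edges x p).
    apply: eq_in_count => A Ap /=.
    have /hasPn/(_ A Ap)/negbTE/= -> := pB.
    by rewrite orbF.
  by move=> ->; rewrite count_uniq_mem ?mp ?walk_edges_uniq.
case: (boolP (all (@cut_edge G) (walk_edges x p))) => [allc|].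
  case: p lp up pG mp {pp pB} allc => [|z [|w p]] lp up pG mp allc.
  - by rewrite -lp eqxx in xy.
  - exists [:: z]; split=> //; exists (c [set x; z]).
    by rewrite /= eqxx.
  - move: allc => /= /and3P[cxz czw _].
    have xw : x != w by move: up => /= /andP[/norP[_ /norP[]]].
    move: mp; rewrite /= !inE.
    by have [->|->] := mE _ _ _ xw cxz czw; rewrite eqxx ?orbT.
rewrite -has_predC => /hasP[A Ap /= ncA].
have [u [v [AE ux vx uv]]] := walk_edge_ends pG Ap.
have [s [cs As c1]] := RP _ (walk_edges_edges pG Ap) ncA.
have sub := cycle_edges_sub As.
(* As a cut-edge, [m] is not on [s]; thus the red edges of [s] are those in [B], exactly one. *)
have ms : m \notin cycle_edges s.
  apply/negP=> ms; have /negP := cut_edge_not_in_cycle cs ms; apply.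
  by apply/mcut/(cycle_edges_edges _ ms); case/and3P: cs.
have c1' : count (predU (pred1 m) B) (cycle_edges s) = 1.
  rewrite -c1 -cB //; apply: eq_in_count => D Ds /=.
  by case: eqP Ds => // ->; rewrite (negbTE ms).
have pB' : ~~ has (predU (pred1 m) B) (walk_edges x p).
  by rewrite has_predU negb_or has_pred1 mp pB.
have [|q [qP _ q1]] := reroute_through_cycle cs c1' pG up pB'.
  exists u, v; split=> //; last exact: sedge_neq.
    by apply: sub; rewrite AE set21.
  by apply: sub; rewrite AE set22.
rewrite lp in qP; exists q; split=> //; exists 1.
by rewrite count_c.
Qed.

(** * Adjacent cut-edges in [C(G)] and the choice of [m] *)

Lemma cut_vertex_lift (G : sgraph) (x y : G) : cut_edge [set x; y] ->
  exists u v : cut_graph G, [/\ val u = x, val v = y & sedge u v].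
Proof.
move=> cxy.
have hx : [exists A : {set G}, cut_edge A && (x \in A)].
  by apply/existsP; exists [set x; y]; rewrite cxy set21.
have hy : [exists A : {set G}, cut_edge A && (y \in A)].
  by apply/existsP; exists [set x; y]; rewrite cxy set22.
by exists (Sub x hx), (Sub y hy); rewrite /= /cut_rel !SubK.
Qed.

Lemma val_edge_eq (G : sgraph) (u v w z : cut_graph G) :
  [set u; v] = [set w; z] -> [set val u; val v] = [set val w; val z].
Proof. by move=> E; rewrite -!imset_set1 -!imsetU E. Qed.

(** Such a path has at most three edges, and its first and third are disjoint; so of two distinct
    edges sharing [v] one is the second. For empty [p], where [head] takes its default, there are no
    two distinct edges. *)
Lemma path4_consecutive_edges (G : sgraph) (x a u v w : G) (p : seq G) :
  uniq [:: x, a & p] -> size p <= 2 -> u != w ->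
  [set u; v] \in walk_edges x (a :: p) ->
  [set v; w] \in walk_edges x (a :: p) ->
  [set u; v] = [set a; head x p] \/ [set v; w] = [set a; head x p].
Proof.
move=> up sz uw.
have neq : [set u; v] != [set v; w].
  apply: contra_neq uw => /setP E.
  have := E u; have := E w; rewrite !inE !eqxx ?orbT (eq_sym u w) orTb.
  case: (eqVneq w u) => // _ /=; case: eqP => //= wv.
  by case: eqP => // uv _; rewrite wv uv.
have share (A B : {set G}) : [set u; v] = A -> [set v; w] = B ->
    (v \in A) && (v \in B).
  by move=> <- <-; rewrite set21 set22.
case: p up sz => [|b [|d [|//]]] /= up _; rewrite !inE.
- by move=> /eqP E /eqP F; rewrite E F eqxx in neq.
- case/orP=> /eqP E; last by left.
  case/orP=> /eqP F; last by right.
  by rewrite E F eqxx in neq.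
- case/or3P=> /eqP E; [|by left|];
  case/or3P=> /eqP F; try (by right); try (by rewrite E F eqxx in neq);
  move: (share _ _ E F) up; rewrite !inE;
  by case/andP=> /orP[]/eqP-> /orP[]/eqP->; rewrite ?eqxx ?orbT ?andbF.
Qed.

Theorem theorem2p6 (G : sgraph) (Gconn : connected G) (Gncomp : ~ complete G)
  (HC : edgeless (cut_graph G) \/
        (linear_forest (cut_graph G) /\
         exists (k : nat) (Q : 'I_k -> {set cut_graph G}),
           1 <= k /\
           injective Q /\
           (forall A : {set cut_graph G},
              A \in components (cut_graph G) <-> exists i : 'I_k, Q i = A) /\
           (forall i : 'I_k, 2 <= #|Q i|) /\
           (forall i j : 'I_k, i <= j -> #|Q i| <= #|Q j|) /\
           (forall i : 'I_k, i.+1 < k -> #|Q i| = 2) /\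
           (forall i : 'I_k, i.+1 = k -> #|Q i| <= 4))) :
  is_cfc G 2.
Proof.
suff [m mcut mE] : exists2 m : {set G}, (m \in edges G -> cut_edge m) &
    forall x y z : G, x != z -> cut_edge [set x; y] -> cut_edge [set y; z] ->
      m = [set x; y] \/ m = [set y; z].
  have [c cf c2] := cf_two_coloring Gconn mcut mE.
  split; last by move=> d; apply: num_colors_ge2.
  by exists c; split=> //; apply/eqP; rewrite eqn_leq c2 num_colors_ge2.
have set0_edge : set0 \in edges G -> cut_edge (set0 : {set G}).
  rewrite inE => /existsP[u /existsP[v /andP[_ /eqP E]]].
  by have := in_set0 u; rewrite E set21.
case: HC => [C0|[[_ Cpath] [k [Q [k0 [_ [Qcomp [_ [_ [Q2 Q4]]]]]]]]]].
  exists set0 => // x y z _ /cut_vertex_lift[u [v [_ _ uv]]].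
  by move: uv; rewrite -mem_edges C0 inE.
have lk : k.-1 < k by rewrite prednK.
(* Indices start at 0, so this is the last component, the only one that may have more than two
   vertices. *)
pose i0 := Ordinal lk.
have Qi0 : Q i0 \in components (cut_graph G) by apply/Qcomp; exists i0.
have sQ : #|Q i0| <= 4 by apply: Q4; rewrite /= prednK.
have [x0 [p [up Qp Qe]]] := Cpath _ Qi0.
have lift x y z : x != z -> cut_edge [set x; y] -> cut_edge [set y; z] ->
    exists u v w : cut_graph G,
      [/\ [/\ val u = x, val v = y & val w = z], u != w, sedge u v,
         [set u; v] \in walk_edges x0 p & [set v; w] \in walk_edges x0 p].
  move=> xz /cut_vertex_lift[u [v [ux vy uv]]].
  move=> /cut_vertex_lift[v' [w [vy' wz vw]]].
  have vv : v' = v by apply: val_inj; rewrite vy vy'.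
  rewrite vv in vw => {v' vv vy'}.
  have uw : u != w by apply: contra_neq xz => E; rewrite -ux -wz E.
  exists u, v, w; pose D := [set y | connect (@sedge (cut_graph G)) v y].
  have /Qcomp[i QiD] : D \in components (cut_graph G) by apply: imset_f.
  have uD : u \in D by rewrite inE connect1 // sedge_sym.
  have vD : v \in D by rewrite inE connect0.
  have wD : w \in D by rewrite inE connect1.
  have D3 : 2 < #|D|.
    apply/card_gt2P; exists u, v, w; split; split=> //; first exact: sedge_neq.
      exact: sedge_neq.
    by rewrite eq_sym.
  (* Two adjacent cut-edges put three vertices in their component, which must then be the last
     one. *)
  have ii0 : i = i0.
    apply: val_inj => /=; have := ltn_ord i.
    rewrite leq_eqVlt => /orP[/eqP/(congr1 predn)//|/Q2 Q2i].
    by rewrite -QiD Q2i in D3.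
  by rewrite -!Qe -?ii0 ?QiD.
case: p up Qp Qe lift => [|a p] up Qp Qe lift.
  exists set0 => // x y z xz cxy cyz.
  by have [u [v [w []]]] := lift _ _ _ xz cxy cyz.
have szp : size p <= 2.
  by move: sQ; rewrite (eq_card Qp) (card_uniqP up).
(* The second edge of the path [x0, a, b, ...]; on two vertices no cut-edges are adjacent and the
   empty set serves. *)
exists (if p is b :: _ then [set val a; val b] else set0).
  case: p up Qp Qe {lift szp} => [|b p] // up Qp Qe _.
  have aQ : a \in Q i0 by rewrite Qp !inE eqxx orbT.
  have bQ : b \in Q i0 by rewrite Qp !inE eqxx !orbT.
  by have := Qe _ _ aQ bQ; rewrite /= !inE eqxx orbT.
move=> x y z xz cxy cyz.
have [u [v [w [[<- <- <-] uw uv uvp vwp]]]] := lift _ _ _ xz cxy cyz.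
have := path4_consecutive_edges up szp uw uvp vwp.
case: p {up Qp Qe lift szp} uvp vwp => [|b p] /=.
  rewrite !inE => /eqP E /eqP F.
  have : u \in [set v; w] by rewrite F -E set21.
  by rewrite !inE (negbTE uw) orbF => /eqP uv'; rewrite uv' sedge_irr in uv.
by move=> _ _ [] E; [left|right]; apply/esym/val_edge_eq.
Qed.
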